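(* Let $d \ge 0$ be an integer and let $f \colon S^d \to \mathbb{R}^{(d+1) \times (d+1)}$ be an odd and continuous map. Then there is an $x \in S^d$ such that either $f(x)$ does not have rows in intersecting cube facets, or there is a permutation $\pi$ of $[d+1]$ such that $f(x)_{\pi(i)i} \ge 0$ and $|f(x)_{\pi(i)i}| \ge |f(x)_{\pi(i)j}|$ for all $i, j \in [d+1]$.
   Context: $[n] = \{1,\dots,n\}$. $S^d$ is the unit sphere in $\mathbb{R}^{d+1}$. A map $f$ from $S^d$ to a space of real matrices is odd if $f(-x) = -f(x)$ for all $x \in S^d$. For a matrix $M$, $M_{ij}$ denotes the entry in row $i$ and column $j$. A matrix $A \in \mathbb{R}^{m \times m}$ has rows in intersecting cube facets if for any two distinct rows $a$ and $b$ of $A$ (that is, rows with different indices; they may coincide as vectors) and any $j \in [m]$ such that $|a_j| \ge |a_i|$ and $|b_j| \ge |b_i|$ for all $i \in [m]$, one has $a_j b_j > 0$. *)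

(* Defs.v *)
From HB Require Import structures.
From mathcomp Require Import all_boot all_order all_algebra all_fingroup.
From mathcomp Require Import all_classical all_reals all_analysis.

Set Implicit Arguments.
Unset Strict Implicit.
Unset Printing Implicit Defensive.

Import Order.TTheory GRing.Theory Num.Theory.
Import numFieldNormedType.Exports.

Local Open Scope classical_set_scope.
Local Open Scope ring_scope.

(* The norm [`|x|] on ['rV[R]_n] is the sup norm, whose unit sphere is the
   boundary of a cube; the Euclidean sphere has to be written out.  The
   topology on ['rV[R]_n] is the usual one. *)
Definition unit_sphere (R : realType) (d : nat) : set 'rV[R]_d.+1 :=
  [set x | \sum_(i < d.+1) x ord0 i ^+ 2 = 1].

(* [f] is total; only its values on the sphere matter. *)
Definition odd_on_sphere (R : realType) (d m n : nat)
    (f : 'rV[R]_d.+1 -> 'M[R]_(m, n)) : Prop :=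
  forall x, unit_sphere x -> f (- x) = - f x.

(* Distinct rows are rows with distinct indices [r] and [s]; they may be equal
   as vectors. *)
Definition rows_in_intersecting_cube_facets (R : realType) (m : nat)
    (A : 'M[R]_m) : Prop :=
  forall r s : 'I_m, r != s -> forall j : 'I_m,
    (forall i : 'I_m, `|A r i| <= `|A r j|) ->
    (forall i : 'I_m, `|A s i| <= `|A s j|) ->
    0 < A r j * A s j.

(* Main.v *)
Require Import Defs.
From HB Require Import structures.
From mathcomp Require Import all_boot all_order all_algebra all_fingroup.
From mathcomp Require Import all_classical all_reals all_analysis.

Set Implicit Arguments.
Unset Strict Implicit.
Unset Printing Implicit Defensive.

Import Order.TTheory GRing.Theory Num.Theory.
Import numFieldNormedType.Exports.

(** Why the theorem is true.

Suppose that no [f x] satisfies the conclusion. Attach to every vertex of a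
fine antipodal triangulation of the d-sphere a row index, its tag, so that the
vertices of one simplex carry different tags. A vertex [v] with tag [t] is
labelled by a column [j] in which row [t] of [f v] is maximal in absolute
value, together with the sign of that entry. A matrix with a zero row satisfies
the conclusion (lemma [colmax_alternative]), so the entry is nonzero and
antipodal vertices get the same column and opposite signs. Two vertices of one
simplex never get the same column with opposite signs: they carry different
tags and are close to each other, so for a fine triangulation this would
contradict, up to a small error, that the rows of [f x] lie in intersecting
cube facets.

These are the hypotheses of Ky Fan's lemma: the number of top-dimensional
simplices whose labels, sorted by column, have alternating signs starting with
a prescribed sign is odd.  Such a simplex has [d.+1] vertices with distinct
columns, so every column occurs exactly once, and every tag occurs exactly
once; this matches rows with columns.  To make all the matched entries
positive rather than alternating, the sign of column [j] is multiplied by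
[(-1)^j] before Fan's lemma is applied.  The barycentric subdivision supplies
the tags for free: the new vertex of a flag of faces is tagged by the dimension
of the face of which it is the barycentre.  So a single use of Fan's lemma
replaces the Borsuk-Ulam theorem followed by the Birkhoff-von Neumann theorem.

The argument yields, for every [e > 0], points within distance [e] of each
other, one for each row, such that the matrix formed by the corresponding rows
of their values satisfies the conclusion (lemma [approx_alternative]).  The
matrices that satisfy the conclusion form a closed set, and the sphere is
compact, so a cluster point of these points proves the theorem.

Fan's lemma (theorem [fan_odd]) is proved with chains modulo 2.  Let [F k] be
the chain of a (k-1)-sphere and [H k] that of a hemisphere of [F k.+1], so
that [F k.+1] is [H k] plus its antipode and the boundary of [H k] is [F k].
Let [fan b] be the cochain that detects alternating simplices with first sign
[b].  Its coboundary is [fan b + fan (~~ b)], and the antipode exchanges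
[fan b] and [fan (~~ b)].  Hence [fan true] has the same value on [F k.+1] as
[fan true + fan false] on [H k], and as [fan true] on the boundary [F k] of
[H k].  By induction this value is the one on the empty simplex, which is 1.
The chains start as those of the octahedral sphere, and the barycentric
subdivision preserves the relations between them. *)

(** * Chains and cochains modulo 2 *)

Section Chains.
Variable T : eqType.
Implicit Types (a : seq T -> bool) (s : seq T) (c : seq (seq T)).

(** A chain modulo 2 is a list of simplices and a simplex is a list of vertices;
    two chains are never compared directly, but through the values on them of
    all cochains [a]. *)
Definition eval a c := \big[addb/false]_(s <- c) a s.

(** The empty simplex is a face of every vertex, so this is the augmented
    complex: the boundary of a cone is then given by one formula, even over the
    empty simplex. *)
Fixpoint faces s : seq (seq T) :=
  if s is x :: s' then s' :: map (cons x) (faces s') else [::].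

Definition cobd a s := eval a (faces s).

Lemma eval_cat a c1 c2 : eval a (c1 ++ c2) = eval a c1 (+) eval a c2.
Proof. by rewrite /eval big_cat. Qed.

Lemma eval_addb a1 a2 c :
  eval (fun s => a1 s (+) a2 s) c = eval a1 c (+) eval a2 c.
Proof. by rewrite /eval big_split. Qed.

Lemma eval_map (f : seq T -> seq T) a c : eval a (map f c) = eval (a \o f) c.
Proof. by rewrite /eval big_map. Qed.

Lemma eval_flatten_map (f : seq T -> seq (seq T)) a c :
  eval a (flatten (map f c)) = eval (fun s => eval a (f s)) c.
Proof. by rewrite /eval big_flatten big_map. Qed.

Lemma eq_in_eval a1 a2 c : {in c, a1 =1 a2} -> eval a1 c = eval a2 c.
Proof. by move=> e; apply: eq_big_seq. Qed.

Lemma eq_eval a1 a2 c : a1 =1 a2 -> eval a1 c = eval a2 c.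
Proof. by move=> e; apply: eq_bigr. Qed.

Lemma eval_true_has a c : eval a c -> exists2 s, s \in c & a s.
Proof.
move=> h; apply/hasP; apply: contraTT h => /hasPn h.
by rewrite /eval big1_seq // => s /andP[_ /h /negbTE].
Qed.

Lemma cobd_cons a x s : cobd a (x :: s) = a s (+) cobd (a \o cons x) s.
Proof. by rewrite /cobd/= /eval big_cons big_map. Qed.

Lemma cobd_cons_eval a x c :
  eval (cobd a) (map (cons x) c) = eval a c (+) eval (cobd (a \o cons x)) c.
Proof.
rewrite eval_map -eval_addb; apply: eq_eval => s /=; exact: cobd_cons.
Qed.

Lemma cobdK a s : cobd (cobd a) s = false.
Proof.
elim: s a => [|x s IHs] a; first by rewrite /cobd /eval big_nil.
rewrite {1}/cobd /= /eval big_cons -/(eval _ _) cobd_cons_eval.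
by rewrite -/(cobd a s) addbA addbb -/(cobd _ s) IHs.
Qed.

Lemma size_faces s t : t \in faces s -> size s = (size t).+1.
Proof.
elim: s t => [|x s IHs] t //=; rewrite inE => /orP[/eqP -> //|].
by case/mapP => u /IHs us ->; rewrite us.
Qed.

Lemma subseq_faces s t : t \in faces s -> subseq t s.
Proof.
elim: s t => [|x s IHs] t //=; rewrite inE => /orP[/eqP ->|].
  exact: subseq_cons.
by case/mapP => u /IHs us -> /=; rewrite eqxx.
Qed.

(** For a symmetric cochain the faces may be taken in any order, since removing a
    position amounts to removing its entry. *)
Lemma cobd_sym a s : (forall s t, perm_eq s t -> a s = a t) ->
  cobd a s = \big[addb/false]_(x <- s) a (rem x s).
Proof.
elim: s a => [|x s IHs] a asym; first by rewrite /cobd /eval !big_nil.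
rewrite cobd_cons big_cons /= eqxx; congr (_ (+) _).
rewrite IHs => [|t u tu]; last by apply: asym; rewrite perm_cons.
apply: eq_big_seq => y ys /=; case: eqP => // xy; apply: asym.
by rewrite xy perm_sym perm_to_rem.
Qed.

Lemma perm_cobd a s t : (forall s t, perm_eq s t -> a s = a t) ->
  perm_eq s t -> cobd a s = cobd a t.
Proof.
move=> asym st; rewrite !cobd_sym // (perm_big _ st) /=.
apply: eq_big_seq => x xt; apply: asym.
have xs : x \in s by rewrite (perm_mem st).
rewrite -(perm_cons x) -(permPl (perm_to_rem xs)) (permPl st).
exact: perm_to_rem.
Qed.
End Chains.

Lemma faces_map (T U : eqType) (f : T -> U) s :
  faces (map f s) = map (map f) (faces s).
Proof.
elim: s => //= x s ->; congr cons; rewrite -!map_comp; exact: eq_map.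
Qed.

Lemma cobd_map (T U : eqType) (f : T -> U) (a : seq U -> bool) s :
  cobd a (map f s) = cobd (a \o map f) s.
Proof. by rewrite /cobd faces_map /eval big_map. Qed.

(** * The alternating cochains of Ky Fan *)

Fixpoint alternating (b : bool) (s : seq bool) :=
  if s is x :: s' then (x == b) && alternating (~~ b) s' else true.

(** Induction on the first entry [x].  If [x = b], dropping [x] from [x :: s] and
    the faces of [s] together count [alternating b s] twice, leaving
    [alternating (~~ b) s]; if [x != b], only dropping [x] can give a sequence
    that starts with [b]. *)
Lemma cobd_alternating b s :
  cobd (alternating b) s = alternating b s (+) alternating (~~ b) s.
Proof.
elim: s b => [|x s IHs] b; first by rewrite /cobd /eval big_nil.
rewrite cobd_cons.
have -> : cobd (alternating b \o cons x) s =
    (x == b) && cobd (alternating (~~ b)) s.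
  by rewrite /cobd /eval big_distrr.
by rewrite IHs; case: x b => [] [] /=; rewrite ?addbF // addbCA addbb addbF.
Qed.

Lemma sort_leq_sorted s : sorted leq (sort leq s).
Proof. by apply: sort_sorted; exact: leq_total. Qed.

(** The label in column [j] with sign [e] is encoded as the number [2 * j + e], so
    that sorting numbers sorts by column and the parity is the sign. *)
Definition fan b (s : seq nat) := alternating b (map odd (sort leq s)).

Lemma fan_perm b s t : perm_eq s t -> fan b s = fan b t.
Proof.
by move=> /(perm_sortP leq_total leq_trans anti_leq) st; rewrite /fan st.
Qed.

(** A face of a sorted simplex is sorted, so on sorted simplices [fan] is the
    cochain [alternating]; the general case follows by symmetry. *)
Lemma cobd_fan b s : cobd (fan b) s = fan b s (+) fan (~~ b) s.
Proof.
have ss : perm_eq s (sort leq s) by rewrite perm_sym perm_sort.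
rewrite (perm_cobd (@fan_perm b) ss) {2 3}/fan -cobd_alternating cobd_map.
apply: eq_in_eval => t /subseq_faces tsub; rewrite /fan /=.
rewrite (sorted_sort leq_trans) //.
exact: (subseq_sorted leq_trans tsub (sort_leq_sorted s)).
Qed.

(** The label in the same column with the opposite sign. *)
Definition opp_code c := if odd c then c.-1 else c.+1.

Definition noncomplementary (s : seq nat) :=
  forall c, c \in s -> opp_code c \notin s.

Lemma odd_opp_code c : odd (opp_code c) = ~~ odd c.
Proof. by rewrite /opp_code; case: c => //= c; case oc: (odd c); rewrite /= oc. Qed.

Lemma half_opp_code c : (opp_code c)./2 = c./2.
Proof.
rewrite /opp_code; case: ifP => [|oc]; last by rewrite /= uphalf_half oc.
by case: c => //= c; rewrite uphalf_half => /negbTE ->.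
Qed.

Lemma codeE c : c = c./2.*2 + odd c.
Proof. by rewrite addnC odd_double_half. Qed.

Lemma opp_codeE c c' : c./2 = c'./2 -> odd c != odd c' -> c' = opp_code c.
Proof.
rewrite (codeE (opp_code c)) {3}(codeE c') half_opp_code odd_opp_code => ->.
by case: (odd c) => [] /=; case: (odd c').
Qed.

(** Changing all signs keeps the order of the labels, unless both signs occur in
    one column. *)
Lemma fan_opp b s : noncomplementary s ->
  fan b (map opp_code s) = fan (~~ b) s.
Proof.
move=> nc; rewrite /fan.
have -> : sort leq (map opp_code s) = map opp_code (sort leq s).
  apply: (sorted_eq leq_trans anti_leq); first exact: sort_leq_sorted.
    rewrite sorted_map.
    apply: sub_in_sorted (sort_leq_sorted s); first last.
      by apply/allP => x; rewrite mem_sort; exact: id.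
    move=> x y /= xs ys xy.
    have xy2 : x./2 <= y./2 by rewrite half_leq.
    rewrite (codeE (opp_code x)) (codeE (opp_code y)) !half_opp_code !odd_opp_code.
    move: xy2; rewrite leq_eqVlt => /orP[/eqP xy2|xy2].
      have [oxy|nxy] := eqVneq (odd x) (odd y); first by rewrite xy2 oxy.
      by move: (nc _ xs); rewrite -(opp_codeE xy2 nxy) ys.
    rewrite (leq_trans (n := x./2.*2.+1)) //;
      first by case: odd => //=; rewrite ?addn0 ?addn1.
    rewrite (leq_trans (n := y./2.*2)) ?leq_addr //.
    by rewrite ltn_double.
  rewrite (perm_trans (y := map opp_code s)) ?perm_sort //.
  by rewrite perm_map // perm_sym perm_sort.
rewrite -map_comp; elim: (sort leq s) b => //= c t IH b.
by rewrite IH odd_opp_code; case: (odd c) b => [] [].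
Qed.

Lemma alternating_nth b s i : alternating b s -> i < size s ->
  nth false s i = b (+) odd i.
Proof.
elim: s b i => [|x s IH] b [|i] //=; first by case/andP => /eqP ->; rewrite addbF.
by case/andP => _ /IH h /h ->; rewrite addNb addbN.
Qed.

(** Two neighbours in an alternating list have different signs, hence different
    columns if no column carries both signs.  So [n] labels in [n] columns use
    each column once, and the sign in column [j] is determined by the parity of
    [j]. *)
Lemma fan_full n s : noncomplementary s -> size s = n ->
    {in s, forall c, c./2 < n} -> fan true s ->
  uniq (map half s) /\ {in s, forall c, odd c = ~~ odd c./2}.
Proof.
move=> nc sn lt_n fs; set t := sort leq s.
have st : t =i s by move=> c; rewrite mem_sort.
have tn : size t = n by rewrite size_sort.
have t_sorted : sorted leq t by exact: sort_leq_sorted.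
have odt i : i < n -> odd (nth 0 t i) = ~~ odd i.
  move=> i_n; rewrite -(nth_map 0 false) ?tn // (alternating_nth fs) //.
  by rewrite size_map tn.
have hs : sorted ltn (map half t).
  apply/(sortedP 0) => i; rewrite size_map tn => i1n.
  have i_n : i < n by apply: leq_trans i1n.
  rewrite !(nth_map 0) ?tn //.
  have /(sortedP 0)/(_ i) := t_sorted; rewrite tn => /(_ i1n) le.
  rewrite /= ltn_neqAle half_leq // andbT; apply/eqP => e.
  have /nc : nth 0 t i \in s by rewrite -st mem_nth ?tn.
  rewrite -(opp_codeE e) -?st ?mem_nth ?tn //.
  by rewrite !odt //=; case: (odd i).
have ut : map half t = iota 0 n.
  apply: (irr_sorted_eq ltn_trans ltnn hs (iota_ltn_sorted 0 n)).
  have u := sorted_uniq ltn_trans ltnn hs.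
  apply: (uniq_min_size u _ _).2.
    move=> j /mapP[c]; rewrite st => cs ->.
    by rewrite mem_iota /= add0n lt_n.
  by rewrite size_iota size_map tn.
split.
  rewrite (perm_uniq (s2 := map half t)) ?ut ?iota_uniq //.
  by rewrite -ut perm_map // perm_sym perm_sort.
move=> c; rewrite -st => /(nthP 0)[i]; rewrite tn => i_n <-.
rewrite odt //; congr (~~ odd _).
by rewrite -(nth_map 0 0) ?tn // ut nth_iota.
Qed.

Local Open Scope classical_set_scope.
Local Open Scope ring_scope.

(** * Barycentric subdivision of tagged simplices *)

Section Subdivision.
Variables (R : fieldType) (V : lmodType R).
Implicit Types (s t : seq (V * nat)) (a : seq (V * nat) -> bool).

Definition bary (s : seq V) : V := (size s)%:R^-1 *: \sum_(v <- s) v.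

Definition antipode s := [seq (- v.1, v.2) | v <- s].

(** The cone from the barycentre over the subdivided boundary, for a simplex [s]
    with [n] vertices.  The new vertex is tagged by the dimension [n.-1] of [s],
    whatever the tags in [s] were. *)
Fixpoint subdivide n s : seq (seq (V * nat)) :=
  if n is n'.+1 then
    map (cons (bary (map fst s), n')) (flatten (map (subdivide n') (faces s)))
  else [:: [::]].

Lemma bary_opp (s : seq V) : bary (map -%R s) = - bary s.
Proof. by rewrite /bary size_map big_map sumrN scalerN. Qed.

Lemma faces_antipode s : faces (antipode s) = map antipode (faces s).
Proof. exact: faces_map. Qed.

Lemma subdivide_antipode n s : subdivide n (antipode s) = map antipode (subdivide n s).
Proof.
elim: n s => //= n IH s.
have -> : map fst (antipode s) = map -%R (map fst s) by rewrite -!map_comp.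
rewrite bary_opp faces_antipode.
have -> : flatten (map (subdivide n) (map antipode (faces s))) =
    map antipode (flatten (map (subdivide n) (faces s))).
  rewrite map_flatten -!map_comp; congr flatten.
  by apply: eq_map => u /=; rewrite IH.
by rewrite -!map_comp.
Qed.

(** Subdivision is a chain map.  By induction the boundary of the cone is its base
    plus the cone over the subdivision of the boundary of the boundary, which
    is 0. *)
Lemma cobd_subdivide a n s : size s = n ->
  eval (cobd a) (subdivide n s) = cobd (fun t => eval a (subdivide n.-1 t)) s.
Proof.
elim: n a s => [|n IH] a s sn.
  by rewrite (size0nil sn) /cobd /eval big_seq1 !big_nil.
rewrite /= cobd_cons_eval !eval_flatten_map -/(cobd _ s).
set b := eval _ _; suff -> : b = false by rewrite addbF.
rewrite -(cobdK (fun t => eval (a \o cons (bary (map fst s), n)) (subdivide n.-1 t)) s).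
apply: eq_in_eval => u us; apply: IH.
by have := size_faces us; rewrite sn => -[].
Qed.

(** Nested spheres and hemispheres at the level of chains: [F k] stands for the
    sphere of dimension [k - 1] and [H k] for a hemisphere, of dimension [k], of
    [F k.+1].  The sphere [F 0] of dimension -1 is the empty simplex. *)
Record hemispheres (F H : nat -> seq (seq (V * nat))) : Prop := Hemispheres {
  hemi_0 : forall a, eval a (F 0) = a [::];
  hemi_sphere : forall k a,
    eval a (F k.+1) = eval a (H k) (+) eval a (map antipode (H k));
  hemi_bd : forall k a, eval (cobd a) (H k) = eval a (F k);
  hemi_size : forall k s, s \in H k -> size s = k.+1 }.

(** The shift [n] is the number of vertices of the simplices of [c 0]. *)
Definition subdivide_family (c : nat -> seq (seq (V * nat))) n k :=
  flatten (map (subdivide (k + n)) (c k)).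

Lemma size_subdivide n s t : t \in subdivide n s -> size t = n.
Proof.
elim: n s t => [|n IH] s t /=; first by rewrite inE => /eqP ->.
case/mapP => u /flattenP[c /mapP[f _ ->] /IH <-] ->; by [].
Qed.

Lemma mem_subdivide_family c n k t : t \in subdivide_family c n k ->
  exists2 s, s \in c k & t \in subdivide (k + n) s.
Proof. by case/flattenP => d /mapP[s sc ->]; exists s. Qed.

Lemma hemispheres_subdivide_family F H :
  hemispheres F H -> hemispheres (subdivide_family F 0) (subdivide_family H 1).
Proof.
case=> h0 h1 h2 h3; split.
- move=> a; rewrite /subdivide_family eval_flatten_map h0 /= /eval big_seq1; by [].
- move=> k a; rewrite /subdivide_family !eval_flatten_map addn0 addn1 h1.
  congr (_ (+) _).
  rewrite !eval_map eval_flatten_map; apply: eq_eval => s.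
  change (eval a (subdivide k.+1 (antipode s)) =
    eval (a \o antipode) (subdivide k.+1 s)).
  by rewrite subdivide_antipode eval_map.
- move=> k a; rewrite /subdivide_family !eval_flatten_map addn0 addn1 -h2.
  by apply: eq_in_eval => s /h3 ss; rewrite (cobd_subdivide _ ss).
- by move=> k s /mem_subdivide_family[u _ /size_subdivide]; rewrite addn1.
Qed.

(** Ky Fan's lemma.  Passing from [F k] to [F k.+1] does not change the parity:
    [fan true] on the antipode of [H k] is [fan false] on [H k], and
    [fan true + fan false] is the coboundary of [fan true], whose value on [H k]
    is that of [fan true] on [F k]. *)
Theorem fan_odd F H (lab : V * nat -> nat) m : hemispheres F H ->
    (forall k s v, (k < m)%N -> s \in H k -> v \in s ->
       lab (- v.1, v.2) = opp_code (lab v)) ->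
    (forall k s, (k < m)%N -> s \in H k -> noncomplementary (map lab s)) ->
  eval (fan true \o map lab) (F m).
Proof.
move=> [h0 h1 h2 _] lab_opp nc.
suff h k : (k <= m)%N -> eval (fan true \o map lab) (F k) by exact: h.
elim: k => [|k IH] km; first by rewrite h0.
move: (IH (ltnW km)); rewrite h1 -h2 eval_map -eval_addb.
congr is_true; apply: eq_in_eval => s sH /=.
rewrite -[LHS](cobd_map lab (fan true)) cobd_fan; congr (_ (+) _).
rewrite -(fan_opp true (nc k s km sH)) /antipode -!map_comp.
by congr fan; apply/eq_in_map => v vs /=; rewrite (lab_opp k s).
Qed.

(** * The octahedral sphere *)

Section Octahedron.
Variable axis : nat -> V.

Fixpoint octa k : seq (seq (V * nat)) :=
  if k is k'.+1 then
    map (cons (axis k', k')) (octa k') ++ map (cons (- axis k', k')) (octa k')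
  else [:: [::]].

Definition hemi_octa k := map (cons (axis k, k)) (octa k).

(** The faces through a cone point cancel by induction, and the opposite faces are
    shared by the two cones. *)
Lemma cobd_octa k a : eval (cobd a) (octa k) = false.
Proof.
elim: k a => [|k IH] a; first by rewrite /eval big_seq1 /cobd /eval big_nil.
by rewrite eval_cat !cobd_cons_eval !IH !addbF addbb.
Qed.

Lemma octa_antipode k a : eval a (map antipode (octa k)) = eval a (octa k).
Proof.
elim: k a => [|k IH] a; first by rewrite /eval !big_seq1.
have cone v : eval a (map antipode (map (cons (v, k)) (octa k))) =
    eval a (map (cons (- v, k)) (octa k)).
  by rewrite -map_comp [RHS]eval_map -IH !eval_map.
by rewrite map_cat !eval_cat !cone opprK addbC.
Qed.

Lemma hemispheres_octa : hemispheres octa hemi_octa.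
Proof.
split.
- by move=> a; rewrite /eval big_seq1.
- move=> k a; rewrite eval_cat; congr (_ (+) _).
  by rewrite /hemi_octa -map_comp [LHS]eval_map -octa_antipode !eval_map.
- by move=> k a; rewrite cobd_cons_eval cobd_octa addbF.
- move=> k s /mapP[t tk ->] /=; congr _.+1.
  elim: k t tk => [|k IH] t /=; first by rewrite inE => /eqP ->.
  by rewrite mem_cat => /orP[] /mapP[u /IH <- ->].
Qed.
End Octahedron.

(** * Geometry of the subdivision *)

Lemma subdivide_tags n s t : t \in subdivide n s ->
  uniq (map snd t) /\ {in t, forall v, (v.2 < n)%N}.
Proof.
elim: n s t => [|n IH] s t /=; first by rewrite inE => /eqP ->.
case/mapP => u /flattenP[c /mapP[f _ ->] /IH[uu un]] ->; split => /=.
  rewrite uu andbT; apply/mapP => -[v /un + e]; by rewrite -e ltnn.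
by move=> v; rewrite inE => /orP[/eqP ->//|/un /ltnW].
Qed.

(** Convexity in the form in which subdivision uses it; the instances are balls and
    facets of the octahedron. *)
Definition convex_pred (P : V -> Prop) :=
  forall s : seq V, s != [::] -> {in s, forall v, P v} -> P (bary s).

Lemma subdivide_convex P n s t : convex_pred P -> size s = n ->
  {in s, forall v, P v.1} -> t \in subdivide n s -> {in t, forall v, P v.1}.
Proof.
move=> cP; elim: n s t => [|n IH] s t sn Ps /=; first by rewrite inE => /eqP ->.
case/mapP => u /flattenP[c /mapP[f fs ->] uf] -> v; rewrite inE => /orP[/eqP ->|].
  apply: cP => [|w /mapP[x /Ps + ->]//]; by case: (s) sn.
apply: IH uf v; first by have := size_faces fs; rewrite sn => -[].
by move=> w wf; apply: Ps; exact: (mem_subseq (subseq_faces fs)).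
Qed.

End Subdivision.

Section Mesh.
Variables (R : realType) (V : normedModType R).
Implicit Types (s t : seq (V * nat)) (r : R).

Lemma subr_bary (p : V) (s : seq V) : s != [::] ->
  p - bary s = (size s)%:R^-1 *: \sum_(v <- s) (p - v).
Proof.
move=> s0; rewrite /bary big_split /= sumrN big_const_seq count_predT.
rewrite iter_addr_0 scalerDr scalerN -[p *+ _]scaler_nat scalerA mulVf ?scale1r //.
by rewrite pnatr_eq0 size_eq0.
Qed.

Lemma convex_ball (p : V) r : convex_pred (fun v => `|p - v| <= r).
Proof.
move=> s s0 sr; rewrite subr_bary // normrZ normfV normr_nat.
have n0 : 0 < (size s)%:R :> R by rewrite ltr0n lt0n size_eq0.
rewrite ler_pdivrMl // (le_trans (ler_norm_sum _ _ _)) //.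
rewrite (le_trans (y := \sum_(v <- s) r)) //.
  by rewrite big_seq [leRHS]big_seq ler_sum.
by rewrite big_const_seq count_predT iter_addr_0 mulr_natl.
Qed.

(** The vertex [w] itself contributes 0 to the mean of the differences [w - v]; this
    gives the factor [1 - 1/n]. *)
Lemma bary_mesh (s : seq V) r w : w \in s ->
    {in s &, forall v w, `|v - w| <= r} ->
  `|w - bary s| <= (1 - (size s)%:R^-1) * r.
Proof.
move=> ws sr; have s0 : s != [::] by case: (s) ws.
have n0 : 0 < (size s)%:R :> R by rewrite ltr0n lt0n size_eq0.
rewrite subr_bary // normrZ normfV normr_nat ler_pdivrMl // mulrA mulrBr.
rewrite mulr1 divff ?gt_eqF // (perm_big _ (perm_to_rem ws)) big_cons /= subrr add0r.
rewrite (le_trans (ler_norm_sum _ _ _)) //.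
rewrite (le_trans (y := \sum_(v <- rem w s) r)) //.
  by rewrite big_seq [leRHS]big_seq ler_sum // => v /mem_rem vs; exact: sr.
rewrite big_const_seq count_predT iter_addr_0 size_rem // -[r *+ _]mulr_natl.
by rewrite -subn1 natrB // lt0n size_eq0.
Qed.

Definition mesh r s := {in s &, forall v w, `|v.1 - w.1| <= r}.

(** Faces have fewer vertices, so their factors are smaller, and by induction only
    the distances from the barycentre remain; these are bounded on the vertices
    of [s], hence on the convex hull of [s]. *)
Lemma subdivide_mesh (m n : nat) r s t : size s = n -> (n <= m)%N -> 0 <= r ->
  mesh r s ->
  t \in subdivide n s -> mesh ((1 - m%:R^-1) * r) t.
Proof.
move=> + + r0; elim: n s t => [|n IH] s t sn nm sr /=.
  by rewrite inE => /eqP -> ?.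
case/mapP => u /flattenP[c /mapP[f fs ->] uf] ->.
have fn : size f = n by have := size_faces fs; rewrite sn => -[].
have sf := mem_subseq (subseq_faces fs).
have um : mesh ((1 - m%:R^-1) * r) u.
  by apply: IH uf => //; [exact: ltnW|move=> v w /sf vs /sf ws; exact: sr].
have m0 : 0 < m%:R :> R by rewrite ltr0n (leq_trans _ nm).
set q := 1 - _ in um *.
have ub : {in u, forall v, `|bary (map fst s) - v.1| <= q * r}.
  apply: subdivide_convex (@convex_ball (bary (map fst s)) (q * r)) fn _ uf.
  move=> w /sf ws; rewrite distrC.
  have h : {in map fst s &, forall v w, `|v - w| <= r}.
    by move=> ? ? /mapP[x xs ->] /mapP[y ys ->]; exact: sr.
  rewrite (le_trans (bary_mesh (map_f fst ws) h)) // ler_wpM2r //.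
  rewrite /q lerD2l lerN2 size_map sn lef_pV2 ?posrE ?ler_nat // ltr0n //.
move=> v w; rewrite !inE => /orP[/eqP ->|vu] /orP[/eqP ->|wu] /=.
- rewrite subrr normr0 mulr_ge0 // subr_ge0 invf_le1 // ler1n.
  exact: leq_trans nm.
- exact: ub.
- by rewrite distrC; exact: ub.
- exact: um.
Qed.
End Mesh.

Section Octant.
Variables (R : realType) (d : nat).
Local Notation V := 'rV[R]_d.+1.
Implicit Types (e : nat -> bool).

Definition l1_sphere : set V := [set v : V | \sum_i `|v ord0 i| = 1].

(** The facet of the l1 sphere with sign vector [e].  The norm of ['rV_n] is the
    sup norm, so the l1 norm is written as a sum; on a facet it is linear. *)
Definition in_octant e (v : V) :=
  (forall i : 'I_d.+1, 0 <= (-1) ^+ e i * v ord0 i) /\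
  \sum_(i < d.+1) (-1) ^+ e i * v ord0 i = 1.

Lemma octant_l1 e v : in_octant e v -> l1_sphere v.
Proof.
rewrite /l1_sphere /= => -[v0 <-]; apply: eq_bigr => i _.
by rewrite -[RHS]ger0_norm // normrMsign.
Qed.

Lemma l1_norm v : l1_sphere v -> `|v| <= 1.
Proof.
rewrite /l1_sphere /= => <-; rewrite [leLHS]/Num.norm/= mx_normrE.
apply: bigmax_le => [|[i j] _ /=]; first exact: sumr_ge0.
by rewrite (ord1 i) (bigD1 j) //= lerDl sumr_ge0.
Qed.

Lemma octant_convex e : convex_pred (in_octant e).
Proof.
move=> s s0 se.
have n0 : 0 < (size s)%:R :> R by rewrite ltr0n lt0n size_eq0.
have baryE (i : 'I_d.+1) : (-1) ^+ e i * bary s ord0 i =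
    (size s)%:R^-1 * \sum_(v <- s) (-1) ^+ e i * v ord0 i.
  by rewrite mxE summxE mulrCA mulr_sumr.
split=> [i|].
  rewrite baryE mulr_ge0 ?invr_ge0 ?(ltW n0) // big_seq.
  by apply: sumr_ge0 => v vs; case: (se _ vs).
under eq_bigr do rewrite baryE.
rewrite -mulr_sumr exchange_big /=.
under eq_big_seq => v vs do rewrite (se _ vs).2.
by rewrite big_const_seq count_predT iter_addr_0 mulVf // gt_eqF.
Qed.

Definition axis k : V := delta_mx ord0 (inord k).

Lemma octant_axis e k : (k < d.+1)%N -> in_octant e ((-1) ^+ e k *: axis k).
Proof.
move=> kd.
have E (i : 'I_d.+1) : (-1) ^+ e i * ((-1) ^+ e k *: axis k) ord0 i = (i == inord k)%:R.
  rewrite !mxE eqxx /=; case: eqP => [->|_]; last by rewrite !mulr0.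
  by rewrite inordK // mulr1 -expr2 sqrr_sign.
split=> [i|]; first by rewrite E ler0n.
under eq_bigr do rewrite E.
by rewrite (bigD1 (inord k)) //= eqxx big1 ?addr0 // => i /negbTE ->.
Qed.

(** That the vertices lie on one facet of the octahedron keeps the subdivided
    simplices on the l1 sphere. *)
Record small_simplex r k (s : seq (V * nat)) : Prop := SmallSimplex {
  small_size : size s = k;
  small_uniq : uniq (map snd s);
  small_tag : {in s, forall v, (v.2 < k)%N};
  small_octant : exists e, {in s, forall v, in_octant e v.1};
  small_mesh : mesh r s }.

Lemma octa_small k s : (k <= d.+1)%N -> s \in octa axis k -> small_simplex 2 k s.
Proof.
move=> kd sk.
(* Every vertex is plus or minus an axis vector, and signs never conflict because
   the axes of a simplex are distinct. *)
suff [sz us ts [e se]] : [/\ size s = k, uniq (map snd s),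
    {in s, forall v, (v.2 < k)%N} &
    exists e, {in s, forall v, exists2 i, (i < k)%N & v.1 = (-1) ^+ e i *: axis i}].
  have oe : {in s, forall v, in_octant e v.1}.
    by move=> v /se[i ik ->]; apply: octant_axis; exact: leq_trans kd.
  split=> //; first by exists e.
  move=> v w /oe/octant_l1/l1_norm v1 /oe/octant_l1/l1_norm w1.
  by rewrite (le_trans (ler_normB _ _)) // [2]/(1 + 1) lerD.
elim: k {kd} s sk => [|k IH] s /=.
  by rewrite inE => /eqP ->; split=> //; exists xpredT.
have step (b : bool) t : t \in octa axis k -> let s := ((-1) ^+ b *: axis k, k) :: t in
    [/\ size s = k.+1, uniq (map snd s),
    {in s, forall v, (v.2 < k.+1)%N} &
    exists e, {in s, forall v, exists2 i, (i < k.+1)%N & v.1 = (-1) ^+ e i *: axis i}].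
  case/IH => st ut tt [e te]; split => /=.
  - by rewrite st.
  - by rewrite ut andbT; apply/mapP => -[v /tt + E]; rewrite -E ltnn.
  - by move=> v; rewrite inE => /orP[/eqP -> //|/tt /ltnW].
  - exists (fun i => if i == k then b else e i) => v; rewrite inE => /orP[/eqP ->|].
      by exists k => //; rewrite eqxx.
    case/te => i ik ->; exists i; first exact: ltnW.
    by rewrite ltn_eqF.
rewrite mem_cat => /orP[] /mapP[t tk ->].
- by have := step false t tk; rewrite expr0 scale1r.
- by have := step true t tk; rewrite expr1 scaleN1r.
Qed.

Lemma subdivide_small r k s t : (k <= d.+1)%N -> 0 <= r -> small_simplex r k s ->
  t \in subdivide k s -> small_simplex ((1 - d.+1%:R^-1) * r) k t.
Proof.
move=> kd r0 [sz us ts [e se] ms] tk.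
have [ut tt] := subdivide_tags tk.
split => //; first exact: size_subdivide tk.
  by exists e; exact: subdivide_convex (@octant_convex e) sz se tk.
exact: subdivide_mesh sz kd r0 ms tk.
Qed.

Lemma small_hemispheres N : exists F H, let r := (1 - d.+1%:R^-1) ^+ N * 2 in
  [/\ hemispheres F H,
    forall k s, (k <= d.+1)%N -> s \in F k -> small_simplex r k s &
    forall k s, (k < d.+1)%N -> s \in H k -> small_simplex r k.+1 s].
Proof.
have q0 : 0 <= 1 - d.+1%:R^-1 :> R by rewrite subr_ge0 invf_le1 ?ler1n ?ltr0n.
elim: N => [|N [F [H /= [FH Fs Hs]]]].
  exists (octa axis), (hemi_octa axis); rewrite /= expr0 mul1r; split.
  - exact: hemispheres_octa.
  - exact: octa_small.
  - move=> k s kd sk; apply: octa_small => //.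
    by rewrite /= mem_cat; apply/orP; left.
exists (subdivide_family F 0), (subdivide_family H 1); rewrite /= exprS -mulrA; split.
- exact: hemispheres_subdivide_family.
- move=> k t kd /mem_subdivide_family[s sF]; rewrite addn0 => ts.
  by apply: subdivide_small ts => //; [rewrite mulr_ge0 ?exprn_ge0|exact: Fs].
- move=> k t kd /mem_subdivide_family[s sF]; rewrite addn1 => ts.
  by apply: subdivide_small ts => //; [rewrite mulr_ge0 ?exprn_ge0|exact: Hs].
Qed.

Lemma mesh_to0 (e : R) : 0 < e -> exists N, (1 - d.+1%:R^-1) ^+ N * 2 < e.
Proof.
move=> e0; set q := 1 - _.
have q0 : 0 <= q by rewrite subr_ge0 invf_le1 ?ler1n ?ltr0n.
have q1 : `|q| < 1 by rewrite ger0_norm // gtrBl invr_gt0 ltr0n.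
have e2 : 0 < e / 2 by rewrite divr_gt0.
have /cvgrPdist_lt/(_ _ e2)[N _ /(_ N (leqnn N))] := cvg_expr q1.
rewrite /= sub0r normrN ger0_norm ?exprn_ge0 // ltr_pdivlMr // => h.
by exists N.
Qed.
End Octant.

(** * Approximate solutions *)

Lemma uniq_map_inj (T U : eqType) (h : T -> U) s :
  uniq (map h s) -> {in s &, injective h}.
Proof.
elim: s => //= x s IH /andP[hx us] y z; rewrite !inE.
move=> /orP[/eqP ->|ys] /orP[/eqP ->|zs] // e.
- by move: hx; rewrite e map_f.
- by move: hx; rewrite -e map_f.
- exact: IH.
Qed.

Section Main.
Variables (R : realType) (d : nat).
Local Notation V := 'rV[R]_d.+1.
Implicit Type M : 'M[R]_d.+1.

Definition alternative M := ~ rows_in_intersecting_cube_facets M \/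
  exists p : 'S_d.+1, forall i j : 'I_d.+1,
    0 <= M (p i) i /\ `|M (p i) j| <= `|M (p i) i|.

Definition colmax M t : 'I_d.+1 := [arg max_(j > ord0) `|M t j|]%O.

Lemma colmax_max M t i : `|M t i| <= `|M t (colmax M t)|.
Proof. by rewrite /colmax; case: arg_maxP => // j _ h; exact: h. Qed.

Lemma colmaxN M t : colmax (- M) t = colmax M t.
Proof.
rewrite /colmax; have -> // : (fun j => `|(- M) t j|) = (fun j => `|M t j|).
by apply/funext => j; rewrite mxE normrN.
Qed.

(** A zero row has no nonzero product with another row, and if there is no other
    row the identity permutation will do. *)
Lemma colmax_alternative M t : M t (colmax M t) = 0 -> alternative M.
Proof.
move=> M0; have [facets|] := pselect (rows_in_intersecting_cube_facets M); last by left.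
right; case: (pickP (fun s => s != t)) => [s st|all_t].
  have := facets s t st (colmax M s) (colmax_max M s).
  have Mt0 i : M t i = 0.
    by apply/eqP; rewrite -normr_le0 -(normr0 R) -M0 colmax_max.
  rewrite Mt0 mulr0 ltxx => h; suff : false by [].
  by apply: h => i; rewrite !Mt0.
have eqt (s : 'I_d.+1) : s = t by apply/eqP; have := all_t s; case: eqP.
have Mtt : M t t = 0 by rewrite -[X in M t X](eqt (colmax M t)).
by exists 1%g => i j; rewrite perm1 (eqt i) (eqt j) Mtt.
Qed.

(** The combinatorial core.  A complementary pair of labels in a small simplex
    gives two rows that violate the facet condition, and an alternating simplex
    of top dimension gives the permutation; in both cases the rows come from
    vertices of one simplex. *)
Lemma approx_alternative (g : V -> 'M[R]_d.+1) (e : R) :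
    (forall v, l1_sphere v -> g (- v) = - g v) ->
    (forall v t, l1_sphere v -> g v t (colmax (g v) t) != 0) ->
    0 < e ->
  exists x : 'I_d.+1 -> V, [/\ forall r, l1_sphere (x r),
    forall r s, `|x r - x s| < e & alternative (\matrix_(r, j) g (x r) r j)].
Proof.
move=> g_odd g_neq0 e0.
have [N Ne] := mesh_to0 d e0.
have [F [H /= [FH Fs Hs]]] := small_hemispheres R d N.
set rho := _ * 2 in Ne Fs Hs; apply: contrapT => no.
pose col (v : V * nat) := colmax (g v.1) (inord v.2).
pose ent (v : V * nat) : R := g v.1 (inord v.2) (col v).
(* The parity of the column turns alternating signs into constant signs. *)
pose lab v := (odd (col v) (+) (0 < ent v)%R + (col v).*2)%N.
have half_lab v : (lab v)./2 = col v by rewrite /lab half_bit_double.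
have odd_lab v : odd (lab v) = odd (col v) (+) (0 < ent v).
  by rewrite /lab oddD odd_double addbF oddb.
have onK k s v : small_simplex rho k s -> v \in s -> l1_sphere v.1.
  by case=> _ _ _ [sg so] _ /so/octant_l1.
have nc k s : (k <= d.+1)%N -> small_simplex rho k s -> noncomplementary (map lab s).
  move=> kd ss _ /mapP[v vs ->]; apply/mapP => -[w ws vw].
  have [_ us ts _ ms] := ss.
  have colE : col v = col w.
    by apply: val_inj; rewrite /= -!half_lab -vw half_opp_code.
  have entE : (0 < ent w) = ~~ (0 < ent v).
    have : odd (lab w) = ~~ odd (lab v) by rewrite -vw odd_opp_code.
    by rewrite !odd_lab colE; case: odd; case: (0 < ent w); case: (0 < ent v).
  have tvw : v.2 != w.2.
    apply/eqP => /(uniq_map_inj us vs ws) E.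
    by move: entE; rewrite E; case: (0 < ent w).
  have r_neq : inord v.2 != inord w.2 :> 'I_d.+1.
    apply: contra tvw => /eqP/(congr1 (@nat_of_ord _)).
    rewrite !inordK ?(leq_trans (ts _ _) kd) //.
    by move=> ->.
  (* Only rows [v.2] and [w.2] matter; the others are filled arbitrarily. *)
  apply: no; exists (fun r => if r == inord v.2 then v.1 else w.1); split.
  - by move=> r; case: ifP => _; exact: onK ss _.
  - by move=> r q; do 2 case: ifP => _; apply: le_lt_trans Ne; exact: ms.
  left=> facets.
  have := facets _ _ r_neq (col v).
  rewrite !mxE eqxx eq_sym (negbTE r_neq) [X in g w.1 _ X]colE => h.
  suff : 0 < ent v * ent w.
    have [v0|v0] := boolP (0 < ent v); rewrite v0 in entE.
      by rewrite pmulr_rgt0 // entE.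
    by rewrite pmulr_lgt0 ?entE // (negbTE v0).
  by apply: h => i; rewrite !mxE ?eqxx 1?eq_sym ?(negbTE r_neq) colmax_max.
have : eval (fan true \o map lab) (F d.+1).
  apply: (fan_odd FH) => [k s v kd sH vs|k s kd sH]; last first.
    by apply: (nc k.+1) => //; exact: Hs.
  have Kv := onK _ _ _ _ (Hs _ _ kd sH) vs.
  have colE : col (- v.1, v.2) = col v by rewrite /col /= g_odd // colmaxN.
  apply: opp_codeE; first by rewrite !half_lab colE.
  rewrite !odd_lab colE; have -> : ent (- v.1, v.2) = - ent v.
    by rewrite {1}/ent colE /= g_odd // mxE.
  have : ent v != 0 by exact: g_neq0.
  by rewrite oppr_gt0; case: ltgtP; case: odd.
case/eval_true_has => s sF /= fs; have ss := Fs _ _ (leqnn _) sF.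
have [sz us ts _ ms] := ss.
have lab_lt : {in map lab s, forall c, (c./2 < d.+1)%N}.
  by move=> _ /mapP[v vs ->]; rewrite half_lab.
have lab_size : size (map lab s) = d.+1 by rewrite size_map sz.
have [uh oh] := fan_full (nc d.+1 s (leqnn _) ss) lab_size lab_lt fs.
(* The [d.+1] distinct tags below [d.+1] exhaust the rows. *)
have rowP (r : 'I_d.+1) : exists v, v \in s /\ v.2 = r.
  have : val r \in map snd s.
    have sub : {subset map snd s <= iota 0 d.+1}.
      by move=> _ /mapP[v vs ->]; rewrite mem_iota /= add0n ts.
    have [|_ ->] := uniq_min_size us sub; first by rewrite size_iota size_map sz.
    by rewrite mem_iota /=.
  by case/mapP => v vs E; exists v.
have [x xP] := choice rowP.
have rE r : inord (x r).2 = r by rewrite (xP r).2 inord_val.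
have col_inj : injective (col \o x).
  move=> r q /= /(congr1 val) /=; rewrite -!half_lab => E.
  apply: val_inj; rewrite /= -(xP r).2 -(xP q).2.
  congr snd; rewrite -map_comp in uh.
  by apply: (uniq_map_inj uh) => //; [exact: (xP r).1|exact: (xP q).1].
apply: no; exists (fun r => (x r).1); split.
- by move=> r; exact: onK ss (xP r).1.
- by move=> r q; apply: le_lt_trans Ne; apply: ms; [exact: (xP r).1|exact: (xP q).1].
right; exists ((perm col_inj)^-1)%g => i j.
pose r := ((perm col_inj)^-1)%g i; rewrite -/r.
have colr : col (x r) = i.
  by rewrite -[LHS]/((col \o x) r) -(permE col_inj) /r permKV.
have entr : 0 < ent (x r).
  have := oh _ (map_f lab (xP r).1).
  by rewrite odd_lab half_lab; case: odd; case: (0 < _).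
rewrite !mxE; move: entr; rewrite /ent rE colr => /ltW entr; split=> //.
have cr : colmax (g (x r).1) r = i by rewrite -[RHS]colr /col rE.
by rewrite -cr; exact: colmax_max.
Qed.
End Main.

(** * Passage to the limit *)

Section Limit.
Variables (R : realType) (d : nat).
Local Notation V := 'rV[R]_d.+1.

Lemma closed_le_fun (T : topologicalType) (h k : T -> R) :
  continuous h -> continuous k -> closed [set x | h x <= k x].
Proof.
move=> ch ck; have -> : [set x | h x <= k x] = (k \- h) @^-1` [set y | 0 <= y].
  by apply/seteqP; split => x /=; rewrite subr_ge0.
apply: preimage_closed; last exact: closed_ge.
by move=> x _; apply: continuousB; [exact: ck|exact: ch].
Qed.

Lemma closed_exists (T : topologicalType) (I : finType) (P : I -> T -> Prop) :
  (forall i, closed [set x | P i x]) -> closed [set x | exists i, P i x].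
Proof.
move=> cP; have -> : [set x | exists i, P i x] = \bigcup_(i in setT) [set x | P i x].
  by apply/seteqP; split => x /= [i]; [exists i|exists i].
by apply: closed_bigcup => [|i _]; [exact: finite_finset|exact: cP].
Qed.

Lemma closed_forall (T : topologicalType) I (P : I -> T -> Prop) :
  (forall i, closed [set x | P i x]) -> closed [set x | forall i, P i x].
Proof.
move=> cP; have -> : [set x | forall i, P i x] = \bigcap_(i in setT) [set x | P i x].
  by apply/seteqP; split => x /= h; [move=> i _; exact: h|move=> i; exact: h].
by apply: closed_bigI => i _; exact: cP.
Qed.

Lemma norm_coord_continuous m n (r : 'I_m) (j : 'I_n) :
  continuous (fun M : 'M[R]_(m, n) => `|M r j|).
Proof.
move=> M; apply: (@cvg_norm _ _ _ (nbhs M) _ (fun M : 'M[R]_(m, n) => M r j)).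
exact: coord_continuous.
Qed.

Lemma closed_alternative : closed [set M : 'M[R]_d.+1 | alternative M].
Proof.
have -> : [set M : 'M[R]_d.+1 | alternative M] =
  [set M | exists rsj : 'I_d.+1 * 'I_d.+1 * 'I_d.+1, rsj.1.1 != rsj.1.2 /\
     (forall i, `|M rsj.1.1 i| <= `|M rsj.1.1 rsj.2| /\
                `|M rsj.1.2 i| <= `|M rsj.1.2 rsj.2| /\
                M rsj.1.1 rsj.2 * M rsj.1.2 rsj.2 <= 0)] `|`
  [set M | exists p : 'S_d.+1, forall i j : 'I_d.+1,
    0 <= M (p i) i /\ `|M (p i) j| <= `|M (p i) i|].
  apply/seteqP; split => M [] h; [left|by right|left|by right].
    apply: contrapT => no; apply: h => r s rs j rj sj; rewrite ltNge; apply/negP => le0.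
    by apply: no; exists (r, s, j).
  case: h => -[[r s] j] [/= rs h] facets.
  have := facets r s rs j (fun i => (h i).1) (fun i => (h i).2.1).
  by rewrite ltNge (h j).2.2.
apply: closedU; apply: closed_exists.
  case=> -[r s] j /=; have [rs|rs] := boolP (r != s); last first.
    rewrite (_ : [set x | _] = set0); first exact: closed0.
    by apply/seteqP; split => // M [].
  rewrite (_ : [set x | _] = [set M : 'M[R]_d.+1 | forall i, `|M r i| <= `|M r j| /\
    `|M s i| <= `|M s j| /\ M r j * M s j <= 0]); last first.
    by apply/seteqP; split => M /=; [case|split].
  apply: closed_forall => i.
  apply: closedI; first by apply: closed_le_fun; exact: norm_coord_continuous.
  apply: closedI; first by apply: closed_le_fun; exact: norm_coord_continuous.
  apply: (@closed_le_fun _ (fun M : 'M[R]_d.+1 => M r j * M s j) (fun=> 0)).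
    by move=> M; apply: continuousM; exact: coord_continuous.
  exact: cst_continuous.
move=> p; apply: closed_forall => i; apply: closed_forall => j.
apply: closedI.
  by apply: (@closed_le_fun _ (fun=> 0));
    [exact: cst_continuous|exact: coord_continuous].
by apply: closed_le_fun; exact: norm_coord_continuous.
Qed.

Lemma l1_cont : continuous (fun v : V => \sum_i `|v ord0 i|).
Proof.
apply: continuous_big => [|i _]; first exact: add_continuous.
exact: norm_coord_continuous.
Qed.

Lemma l1_compact : compact (@l1_sphere R d).
Proof.
apply: bounded_closed_compact.
  exists 1; split; first exact: num_real.
  by move=> x x1 v /l1_norm v1; exact: le_trans v1 (ltW x1).
have -> : @l1_sphere R d =
    (fun v : V => \sum_i `|v ord0 i|) @^-1` [set y | y = 1] by [].
by apply: preimage_closed; [move=> x _; exact: l1_cont|exact: closed_eq].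
Qed.

(** The points for the first row cluster at some [v]; the points for the other
    rows are as close to them as desired, so all rows converge to those of
    [g v]. *)
Lemma limit_closed (K : set V) (C : set 'M[R]_d.+1) (g : V -> 'M[R]_d.+1) :
    compact K -> closed C -> {within K, continuous g} ->
    (forall e : R, 0 < e -> exists x : 'I_d.+1 -> V, [/\ forall r, K (x r),
      forall r s, `|x r - x s| < e & C (\matrix_(r, j) g (x r) r j)]) ->
  exists2 v, K v & C (g v).
Proof.
move=> cK cC /subspace_continuousP gK approx.
have /choice[x xP] : forall n : nat, exists x : 'I_d.+1 -> V,
    [/\ forall r, K (x r), forall r s, `|x r - x s| < n.+1%:R^-1 &
     C (\matrix_(r, j) g (x r) r j)].
  by move=> n; apply: approx; rewrite invr_gt0 ltr0n.
have [|v [Kv clv]] := cK ((fun n => x n ord0) @ \oo) _.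
  by exists 0%N => // n _ /=; have [/(_ ord0)] := xP n.
exists v => //; rewrite ((closure_id C).1 cC) => B /nbhs_ballP[e /= e0 eB].
have /= := gK v Kv (ball (g v) e) (nbhsx_ballx _ _ e0).
rewrite /within /= => /nbhs_ballP[del /= del0 gdel].
have del2 : 0 < del / 2 by rewrite divr_gt0.
have Hn : ((fun n => x n ord0) @ \oo)
    [set y | exists2 n, n.+1%:R^-1 < del / 2 & y = x n ord0].
  have [N _ HN] := near_infty_natSinv_lt (PosNum del2).
  by exists N => // n /HN /= nd; exists n.
have [y [[n nd ->] vx]] := clv _ _ Hn (nbhsx_ballx v _ del2).
have [xK xn xC] := xP n.
exists (\matrix_(r, j) g (x n r) r j); split => //; apply: eB.
split=> // r j; rewrite mxE.
have : ball (g v) e (g (x n r)).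
  apply: gdel (xK r).
  rewrite -ball_normE /= -(subrKA (x n ord0)).
  rewrite (le_lt_trans (ler_normD _ _)) // (splitr del) ltrD //.
    by move: vx; rewrite -ball_normE.
  exact: lt_trans nd.
by case=> _; exact.
Qed.

(** The triangulation lives on the l1 sphere, which is carried to the Euclidean one
    by an odd continuous map. *)
Definition normalize (v : V) : V := (Num.sqrt (\sum_i v ord0 i ^+ 2))^-1 *: v.

Lemma sumsq_gt0 (v : V) : l1_sphere v -> 0 < \sum_i v ord0 i ^+ 2.
Proof.
move=> Kv; rewrite lt0r sumr_ge0 ?andbT => [|i _]; last exact: sqr_ge0.
apply/eqP => /psumr_eq0P v0.
have : \sum_i `|v ord0 i| = 1 by [].
rewrite big1 => [/eqP|i _]; first by rewrite eq_sym oner_eq0.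
apply/normr0P; rewrite -sqrf_eq0 v0 // => j _; exact: sqr_ge0.
Qed.

Lemma normalize_sphere v : l1_sphere v -> unit_sphere (normalize v).
Proof.
move=> /sumsq_gt0 v0; rewrite /unit_sphere /=.
under eq_bigr do rewrite mxE exprMn.
by rewrite -mulr_sumr exprVn sqr_sqrtr ?ltW // mulVf // gt_eqF.
Qed.

Lemma normalizeN v : normalize (- v) = - normalize v.
Proof.
rewrite /normalize scalerN; congr (- ((Num.sqrt _)^-1 *: _)).
by apply: eq_bigr => i _; rewrite mxE sqrrN.
Qed.

Lemma normalize_cont v : l1_sphere v -> {for v, continuous normalize}.
Proof.
move=> /sumsq_gt0 v0; pose n u := Num.sqrt (\sum_i (u : V) ord0 i ^+ 2).
have nc : {for v, continuous (fun u => (n u)^-1)}.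
  apply: continuousV; first by rewrite /n sqrtr_eq0 -ltNge.
  apply: (@continuous_comp _ _ _ (fun u : V => \sum_i u ord0 i ^+ 2)).
    apply: (@continuous_big _ _ _ _ xpredT) => [|i _]; first exact: add_continuous.
    by move=> u; apply: continuousM; exact: coord_continuous.
  exact: sqrt_continuous.
exact: (continuousZ nc (@cvg_id _ _)).
Qed.
End Limit.

Theorem theorem1p1 (R : realType) (d : nat)
    (f : 'rV[R]_d.+1 -> 'M[R]_d.+1)
    (f_odd : odd_on_sphere f)
    (f_cont : {within @unit_sphere R d, continuous f}) :
  exists x : 'rV[R]_d.+1, unit_sphere x /\
    (~ rows_in_intersecting_cube_facets (f x) \/
     exists p : 'S_d.+1, forall i j : 'I_d.+1,
       0 <= f x (p i) i /\ `|f x (p i) j| <= `|f x (p i) i|).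
Proof.
pose g v := f (normalize v).
suff [v Kv gv] : exists2 v, l1_sphere v & alternative (g v).
  by exists (normalize v); split => //; exact: normalize_sphere.
apply: contrapT => no.
have g_odd v : l1_sphere v -> g (- v) = - g v.
  by move=> Kv; rewrite /g normalizeN f_odd //; exact: normalize_sphere.
have g_neq0 v t : l1_sphere v -> g v t (colmax (g v) t) != 0.
  by move=> Kv; apply/eqP => /colmax_alternative ?; apply: no; exists v.
apply: no; apply: limit_closed (@l1_compact R d) (@closed_alternative R d) _ _.
  apply/subspace_continuousP => v Kv.
  move/subspace_continuousP: f_cont => /(_ _ (normalize_sphere Kv)) fv.
  apply: cvg_comp fv => A /(normalize_cont Kv) /=; rewrite !nbhs_filterE /= /within /=.
  by apply: filterS => u SA Ku; apply: SA; exact: normalize_sphere.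
by move=> e e0; exact: approx_alternative.
Qed.
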